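(* Let $R$ be a nonzero commutative ring with identity and let $G$ be an abelian group with $G\neq 1$. Then the following are equivalent. (1) $\Phi(\mathfrak{S})=\mathfrak{T}$. (2) Every non-unit principal ideal of $RG$ is an element of $\Phi(\mathfrak{S})$. (3) $R$ is a field of characteristic $2$ and $G$ is a group of order $2$.
   Context: All groups are abelian and written multiplicatively. $RG$ is the group ring of $G$ over $R$. $\mathfrak{S}$ is the set of subgroups of $G$, and $\mathfrak{T}$ is the set of non-unit ideals of $RG$, i.e. ideals different from $RG$. For a subgroup $N$ of $G$, $I(R,N)$ is the augmentation ideal of $RN$, i.e. the kernel of the $R$-algebra homomorphism $RN\to R$ sending every element of $N$ to $1$, and $\Phi(N)=I(R,N)RG$ is the ideal of $RG$ generated by $I(R,N)$. $\Phi(\mathfrak{S})=\{\Phi(N)\mid N\in\mathfrak{S}\}$. *)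

(* Defs.v *)
From HB Require Import structures.
From mathcomp Require Import all_boot all_algebra finmap.
From mathcomp Require Import boolp classical_sets cardinality.
From mathcomp.multinomials Require Import monalg.

Set Implicit Arguments.
Unset Strict Implicit.
Unset Printing Implicit Defensive.

Import GRing.Theory.
Local Open Scope classical_set_scope.
Local Open Scope ring_scope.

HB.mixin Record Group_isAbelian G of Group G := {
  mulgC_subproof : forall x y : G, commute x y
}.

(* Multiplicative abelian groups, possibly infinite. *)
#[short(type="abelianGroupType")]
HB.structure Definition AbelianGroup := {G of Group G & Group_isAbelian G}.

Lemma abelian_mulgC (G : abelianGroupType) : forall x y : G, commute x y.
Proof. exact: mulgC_subproof. Qed.

(* The library makes {malg R[K]} a ring only when K is a monomType, i.e. a
   monoid without nontrivial units; this alias carries the convolution product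
   for a group K, reusing the R-module structure of {malg R[K]}. *)
Definition group_ring (R : comNzRingType) (G : groupType) : Type := {malg R[G]}.

HB.instance Definition _ (R : comNzRingType) (G : groupType) :=
  GRing.Lmodule.copy (group_ring R G) {malg R[G]}.

Section GroupRing.
Context (R : comNzRingType) (G : groupType).
Local Notation RG := (group_ring R G).
Implicit Types (a b c : RG) (r s : R) (g h : G) (d : {fset G}).

Definition gr_one : RG := << (1 : R) *g (1 : G)%g >>.

Definition gr_mul a b : RG :=
  \sum_(g <- msupp a) \sum_(h <- msupp b) << a@_g * b@_h *g (g * h)%g >>.

Lemma gr_mulw d1 d2 a b :
  (msupp a `<=` d1)%fset -> (msupp b `<=` d2)%fset ->
  gr_mul a b =
    \sum_(g <- d1) \sum_(h <- d2) << a@_g * b@_h *g (g * h)%g >> :> {malg R[G]}.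
Proof.
move=> le1 le2; rewrite /gr_mul (big_fset_incl _ le1) /=.
  apply/eq_bigr=> k1 _; apply/big_fset_incl => // k _ /mcoeff_outdom ->.
  by rewrite mulr0 monalgU0.
move=> k _ /mcoeff_outdom ak.
by rewrite big1 => // k' _; rewrite ak mul0r monalgU0.
Qed.

Lemma gr_mul0l : left_zero 0 gr_mul.
Proof. by move=> a; rewrite /gr_mul msupp0 big_seq_fset0. Qed.

Lemma gr_mul0r : right_zero 0 gr_mul.
Proof. by move=> a; rewrite /gr_mul exchange_big msupp0 big_seq_fset0. Qed.

Lemma gr_mulDl : left_distributive gr_mul +%R.
Proof.
move=> a b c.
rewrite (gr_mulw (msuppD_le _ _) (fsubset_refl _)).
rewrite (gr_mulw (fsubsetUl _ (msupp b)) (fsubset_refl _)).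
rewrite (gr_mulw (fsubsetUr (msupp a) _) (fsubset_refl _)).
rewrite -big_split /=; apply/eq_bigr=> k1 _.
rewrite -big_split /=; apply/eq_bigr=> k2 _.
by rewrite mcoeffD mulrDl monalgUD.
Qed.

Lemma gr_mulDr : right_distributive gr_mul +%R.
Proof.
move=> c a b.
rewrite (gr_mulw (fsubset_refl _) (msuppD_le _ _)).
rewrite (gr_mulw (fsubset_refl _) (fsubsetUl _ (msupp b))).
rewrite (gr_mulw (fsubset_refl _) (fsubsetUr (msupp a) _)).
rewrite -big_split /=; apply/eq_bigr=> k1 _.
rewrite -big_split /=; apply/eq_bigr=> k2 _.
by rewrite mcoeffD mulrDr monalgUD.
Qed.

Lemma gr_mulUU r s g h :
  gr_mul << r *g g >> << s *g h >> = << r * s *g (g * h)%g >>.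
Proof.
by rewrite (gr_mulw msuppU_le msuppU_le) !big_seq_fset1 !mcoeffUU.
Qed.

Lemma gr_mulsuml (I : Type) (t : seq I) (F : I -> RG) b :
  gr_mul (\sum_(i <- t) F i) b = \sum_(i <- t) gr_mul (F i) b.
Proof.
exact: (big_morph (gr_mul^~ b) (fun _ _ => gr_mulDl _ _ _) (gr_mul0l _)).
Qed.

Lemma gr_mulsumr (I : Type) (t : seq I) (F : I -> RG) a :
  gr_mul a (\sum_(i <- t) F i) = \sum_(i <- t) gr_mul a (F i).
Proof.
exact: (big_morph (gr_mul a) (fun _ _ => gr_mulDr _ _ _) (gr_mul0r _)).
Qed.

Lemma group_ringE a : a = \sum_(g <- msupp a) (<< a@_g *g g >> : RG).
Proof. exact: monalgE. Qed.

Lemma gr_mulA : associative gr_mul.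
Proof.
move=> a b c; rewrite (group_ringE a) !gr_mulsuml; apply: eq_bigr => i _.
rewrite (group_ringE b) gr_mulsumr !gr_mulsuml gr_mulsumr.
apply: eq_bigr => j _; rewrite (group_ringE c) !gr_mulsumr.
by apply: eq_bigr => k _; rewrite !gr_mulUU mulrA mulgA.
Qed.

Lemma gr_mul1l : left_id gr_one gr_mul.
Proof.
move=> a; rewrite {1}(group_ringE a) gr_mulsumr [RHS]group_ringE.
by apply: eq_bigr => g _; rewrite gr_mulUU mul1r mul1g.
Qed.

Lemma gr_mul1r : right_id gr_one gr_mul.
Proof.
move=> a; rewrite {1}(group_ringE a) gr_mulsuml [RHS]group_ringE.
by apply: eq_bigr => g _; rewrite gr_mulUU mulr1 mulg1.
Qed.

Lemma gr_one_neq0 : gr_one != 0.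
Proof. by rewrite monalgU_eq0 oner_eq0. Qed.

HB.instance Definition _ := GRing.Zmodule_isNzRing.Build (group_ring R G)
  gr_mulA gr_mul1l gr_mul1r gr_mulDl gr_mulDr gr_one_neq0.

Lemma gr_scaleU r s g : r *: (<< s *g g >> : RG) = << r * s *g g >>.
Proof. by apply/malgP => h; rewrite mcoeffZ !mcoeffU mulrnAr. Qed.

Lemma gr_scaleAl r a b : r *: (a * b) = (r *: a) * b.
Proof.
have scE c : r *: c = gr_mul << r *g 1%g >> c.
  rewrite {1}(group_ringE c) scaler_sumr [X in gr_mul _ X]group_ringE.
  rewrite gr_mulsumr.
  by apply: eq_bigr => g _; rewrite gr_scaleU gr_mulUU mul1g.
by rewrite !scE; exact: gr_mulA.
Qed.

HB.instance Definition _ :=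
  GRing.Lmodule_isLalgebra.Build R (group_ring R G) gr_scaleAl.

Definition augmentation a : R := \sum_(g <- msupp a) a@_g.

Lemma augmentationw d a :
  (msupp a `<=` d)%fset -> augmentation a = \sum_(g <- d) a@_g.
Proof. by move=> le; apply: big_fset_incl => // g _ /mcoeff_outdom. Qed.

Lemma augmentationU r g : augmentation << r *g g >> = r.
Proof. by rewrite (augmentationw msuppU_le) big_seq_fset1 mcoeffUU. Qed.

Lemma augmentation_is_zmod_morphism : zmod_morphism augmentation.
Proof.
move=> a b; rewrite (augmentationw (msuppB_le a b)).
rewrite (augmentationw (fsubsetUl _ (msupp b))).
rewrite (augmentationw (fsubsetUr (msupp a) _)).
by rewrite -sumrB; apply: eq_bigr => g _; rewrite mcoeffB.
Qed.

HB.instance Definition _ := GRing.isZmodMorphism.Build (group_ring R G) R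
  augmentation augmentation_is_zmod_morphism.

Lemma augmentation_is_monoid_morphism : monoid_morphism augmentation.
Proof.
split=> [|a b]; first exact: augmentationU.
rewrite [LHS]raddf_sum [augmentation a]/augmentation mulr_suml; apply: eq_bigr => g _.
rewrite [LHS]raddf_sum [augmentation b]/augmentation mulr_sumr; apply: eq_bigr => h _.
exact: augmentationU.
Qed.

HB.instance Definition _ := GRing.isMonoidMorphism.Build (group_ring R G) R
  augmentation augmentation_is_monoid_morphism.

Lemma augmentation_is_scalable : scalable_for *%R augmentation.
Proof.
move=> r a; rewrite (augmentationw (msuppZ_le r a)) mulr_sumr.
by apply: eq_bigr => g _; rewrite mcoeffZ.
Qed.

HB.instance Definition _ := GRing.isScalable.Build R (group_ring R G) R *%R
  augmentation augmentation_is_scalable.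

(* [augmentation] is the R-algebra homomorphism sending every g to 1. *)
Lemma augmentation_unique (f : {lrmorphism group_ring R G -> R | *%R}) :
  (forall g, f << (1 : R) *g g >> = 1) -> f =1 augmentation.
Proof.
move=> f1 a; rewrite [in LHS](group_ringE a) raddf_sum; apply: eq_bigr => g _.
have := linearZ_LR f (a@_g) (<< (1 : R) *g g >> : RG).
by rewrite gr_scaleU mulr1 /= => ->; rewrite [f _]f1 mulr1.
Qed.

End GroupRing.

Section AbelianGroupRing.
Context (R : comNzRingType) (G : abelianGroupType).

Lemma gr_mulC : commutative (@gr_mul R G).
Proof.
move=> a b; rewrite /gr_mul exchange_big /=.
apply: eq_bigr => h _; apply: eq_bigr => g _.
by rewrite mulrC abelian_mulgC.
Qed.

HB.instance Definition _ :=
  GRing.PzRing_hasCommutativeMul.Build (group_ring R G) gr_mulC.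
HB.instance Definition _ := GRing.Lalgebra_isComAlgebra.Build R (group_ring R G).

End AbelianGroupRing.

(* Unlike the library's [idealr_closed], the unit ideal is allowed. *)
Definition is_ideal (S : comNzRingType) (I : set S) : Prop :=
  [/\ I 0, (forall x y, I x -> I y -> I (x + y))
    & (forall a x, I x -> I (a * x))].

Definition ideal_gen (S : comNzRingType) (A : set S) : set S :=
  smallest (@is_ideal S) A.

Definition principal_ideal (S : comNzRingType) (I : set S) : Prop :=
  exists a, I = ideal_gen [set a].

Definition is_subgroup (G : groupType) (N : set G) : Prop :=
  [/\ N 1%g, (forall x y, N x -> N y -> N (x * y)%g)
    & (forall x, N x -> N x^-1%g)].

Definition subgroups (G : groupType) : set (set G) := [set N | is_subgroup N].
Arguments subgroups G _ : clear implicits.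

Definition nonunit_ideals (S : comNzRingType) : set (set S) :=
  [set I | is_ideal I /\ I <> [set: S]].
Arguments nonunit_ideals S _ : clear implicits.

(* RN, for a subgroup N of G, as the subring of RG of the elements supported
   in N. *)
Definition subgroup_ring (R : comNzRingType) (G : groupType) (N : set G) :
    set (group_ring R G) :=
  [set a | forall g, g \in msupp a -> N g].
Arguments subgroup_ring R {G} N _.

Definition augmentation_ideal (R : comNzRingType) (G : groupType) (N : set G) :
    set (group_ring R G) :=
  [set a | subgroup_ring R N a /\ augmentation a = 0].
Arguments augmentation_ideal R {G} N _.

Definition Phi (R : comNzRingType) (G : abelianGroupType) (N : set G) :
    set (group_ring R G) :=
  ideal_gen (augmentation_ideal R N).
Arguments Phi R {G} N _.

Definition is_field (R : comNzRingType) : Prop :=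
  forall x : R, x != 0 -> exists y : R, y * x = 1.

(* Main.v *)
Require Import Defs.
From HB Require Import structures.
From mathcomp Require Import all_boot all_algebra.
From mathcomp Require Import boolp classical_sets cardinality.
From mathcomp Require Import finmap ring.
From mathcomp.multinomials Require Import monalg.

(** In [RG] every [Phi R N] lies in the kernel of the augmentation [eps], since
    [eps] kills the generators.

    Suppose every non-unit principal ideal is some [Phi R N].  Then an element
    [a] with [eps a != 0] generates the unit ideal, so it is a unit
    ([augmentation_neq0_unit]); on constants this says that [R] is a field.
    The remaining information comes from the ideals generated by
    [(1 - g) * (1 - h)] with [g], [h] nontrivial.  Let such an ideal be
    [Phi R N].
    - [N] does not contain [g]: otherwise [1 - g = b (1 - g) (1 - h)], so
      [1 - g] is killed by [1 - b (1 - h)], which has augmentation [1] and is a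
      unit.  By symmetry [N] does not contain [h].
    - In an element of [Phi R N] the coefficients over each coset of [N] add up
      to [0] ([Phi_coset_sum]).  In the expansion [1 - g - h + gh] the terms
      [g] and [h] lie outside [N], so the coset [N] can only balance if [gh] is
      in [N] and [1 + 1 = 0] ([Phi_mul2]).
    Hence [R] has characteristic [2] and [1 - gh] is a multiple of
    [(1 - g) (1 - h)] ([of_mul2]).  If [g^2 <> 1], taking [h = g^2] makes
    [1 - g^3 = (1 - g) (1 + g + g^2)] a multiple of [(1 - g) (1 - g^2)], and
    the difference of the cofactors of [1 - g] has augmentation [3 = 1], so
    [1 - g = 0]; thus [G] has exponent [2] ([exponent2]).  Then
    [(1 - g)^2 = 0], so for distinct [g], [h] we get
    [(1 - g) (1 - gh) = 0]; the coset computation with trivial [N] turns this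
    into [g (gh) = 1], i.e. [h = 1], a contradiction, so [G] has a single
    nontrivial element ([nontrivial_unique]).

    Conversely, for [G = {1, g}] over a field of characteristic [2], the square
    of [a] is the constant [(eps a)^2], so a non-unit ideal lies in [ker eps].
    That kernel is the line [R (g - 1)], which leaves only the ideals
    [0 = Phi R 1] and [ker eps = Phi R G]. *)

Set Implicit Arguments.
Unset Strict Implicit.
Unset Printing Implicit Defensive.

Import GRing.Theory.

Local Open Scope classical_set_scope.
Local Open Scope card_scope.
Local Open Scope ring_scope.

(** * Generated ideals *)

Section Ideals.
Context (S : comNzRingType).
Implicit Types (a b x : S) (A I : set S).

Lemma is_ideal_gen A : is_ideal (ideal_gen A).
Proof.
split.
- by move=> I [[I0 _ _] _].
- move=> x y Ax Ay I IA; case: (IA) => -[_ ID _] _.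
  exact: (ID _ _ (Ax I IA) (Ay I IA)).
- move=> a x Ax I IA; case: (IA) => -[_ _ IM] _.
  exact: (IM _ _ (Ax I IA)).
Qed.

Lemma ideal_gen_min A I : is_ideal I -> A `<=` I -> ideal_gen A `<=` I.
Proof. by move=> idI AI; apply: smallest_sub. Qed.

Lemma mem_ideal_gen A x : A x -> ideal_gen A x.
Proof. exact: sub_gen_smallest. Qed.

Lemma mem_principal a x : ideal_gen [set a] x <-> exists b, x = b * a.
Proof.
split=> [|[b ->]]; last first.
  by have [_ _ IM] := is_ideal_gen [set a]; apply: IM; apply: mem_ideal_gen.
apply: (@ideal_gen_min [set a] [set x | exists b, x = b * a]); last first.
  by move=> _ ->; exists 1; rewrite mul1r.
split=> [|y z [b ->] [c ->]|c y [b ->]]; first by exists 0; rewrite mul0r.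
- by exists (b + c); rewrite mulrDl.
- by exists (c * b); rewrite mulrA.
Qed.

Lemma ideal_eqT I : is_ideal I -> I 1 -> I = [set: S].
Proof.
move=> [_ _ IM] I1; apply/seteqP; split=> // x _.
by rewrite -[x]mulr1; apply: IM.
Qed.

End Ideals.

(** * Coset sums and the ideals Phi R N *)

Section Cosets.
Context (R : comNzRingType) (G : abelianGroupType).
Local Notation RG := (group_ring R G).
Implicit Types (a b : RG) (g h x : G) (r : R) (N : set G).

Definition gr_of g : RG := << (1 : R) *g g >>.

Lemma gr_of1 : gr_of 1%g = 1. Proof. by []. Qed.

Lemma gr_ofM g h : gr_of (g * h)%g = gr_of g * gr_of h.
Proof. by rewrite -[RHS]/(gr_mul _ _) gr_mulUU mulr1. Qed.

Lemma gr_of_inj : injective gr_of.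
Proof.
move=> g h /(congr1 (fun a : RG => a@_g)); rewrite !mcoeffU eqxx mulr1n.
by case: eqVneq => // _ /eqP; rewrite mulr0n oner_eq0.
Qed.

Lemma augmentation_of g : augmentation (gr_of g) = 1.
Proof. exact: augmentationU. Qed.

(** When [N] is a subgroup, [[h | N (x * h)]] is the coset of [x^-1]; a varying
    [x] thus reaches every coset, and left multiplication by [g] turns the sum
    at [x] into the sum at [x * g]. *)
Definition coset_sum N x a : R :=
  \sum_(h <- msupp a | `[< N (x * h)%g >]) a@_h.

Lemma coset_sumw N x (d : {fset G}) a : (msupp a `<=` d)%fset ->
  coset_sum N x a = \sum_(h <- d | `[< N (x * h)%g >]) a@_h.
Proof.
move=> le; rewrite /coset_sum big_mkcond [RHS]big_mkcond.
by apply: big_fset_incl => // h _ /mcoeff_outdom ->; rewrite if_same.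
Qed.

Lemma coset_sumU N x r g :
  coset_sum N x << r *g g >> = r *+ `[< N (x * g)%g >].
Proof.
rewrite (coset_sumw _ _ msuppU_le) big_mkcond big_seq_fset1 mcoeffUU.
by case: ifP.
Qed.

Lemma coset_sum_is_zmod_morphism N x : zmod_morphism (coset_sum N x).
Proof.
move=> a b; rewrite (coset_sumw _ _ (msuppB_le a b)).
rewrite (coset_sumw _ _ (fsubsetUl _ (msupp b))).
rewrite (coset_sumw _ _ (fsubsetUr (msupp a) _)).
by rewrite -sumrB; apply: eq_bigr => g _; rewrite mcoeffB.
Qed.

HB.instance Definition _ N x := GRing.isZmodMorphism.Build (group_ring R G) R
  (coset_sum N x) (coset_sum_is_zmod_morphism N x).

Lemma coset_sum_of N x g :
  coset_sum N x (gr_of g) = (`[< N (x * g)%g >] : nat)%:R.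
Proof. exact: coset_sumU. Qed.

Lemma coset_sumM N x a b :
  coset_sum N x (a * b) = \sum_(g <- msupp a) a@_g * coset_sum N (x * g)%g b.
Proof.
rewrite [LHS]raddf_sum; apply: eq_bigr => g _.
rewrite [LHS]raddf_sum /coset_sum mulr_sumr [RHS]big_mkcond.
by apply: eq_bigr => h _; rewrite /= coset_sumU mulgA; case: ifP.
Qed.

(** The elements with vanishing coset sums form an ideal because multiplication
    permutes the cosets.  It contains the augmentation ideal of [RN]: an element
    supported in [N] meets a coset in its whole support or not at all. *)
Lemma Phi_coset_sum N x a : is_subgroup N -> Phi R N a -> coset_sum N x a = 0.
Proof.
move=> [N1 NM NV].
suff sub : Phi R N `<=` [set b | forall y, coset_sum N y b = 0].
  by move/sub; apply.
apply: ideal_gen_min => [|b [Nb b0] y].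
  split=> [y|b c b0 c0 y|b c c0 y]; first exact: raddf0.
  - by rewrite raddfD /= b0 c0 addr0.
  - by rewrite coset_sumM big1 // => g _; rewrite c0 mulr0.
have yN h : N h -> N (y * h)%g <-> N y.
  move=> Nh; split=> Ny; last exact: NM.
  by rewrite -[y](mulgK h); apply: NM => //; apply: NV.
rewrite /coset_sum big_seq_cond; have [Ny|Ny] := pselect (N y).
  rewrite -[RHS]b0 [RHS]big_seq; apply: eq_bigl => h.
  case: (boolP (h \in _)) => //= hb.
  by apply/asboolP/yN => //; apply: Nb.
by rewrite big_pred0 // => h; apply/negP => /andP[/Nb Nh /asboolP/(yN _ Nh)].
Qed.

Lemma Phi_augmentation N a : Phi R N a -> augmentation a = 0.
Proof.
apply: (@ideal_gen_min _ _ [set b : RG | augmentation b = 0]) => [|b []//].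
split=> [|b c b0 c0|b c c0] /=; first exact: raddf0.
- by rewrite raddfD /= b0 c0 addr0.
- by rewrite rmorphM /= c0 mulr0.
Qed.

Lemma Phi_of N g : is_subgroup N -> N g -> Phi R N (1 - gr_of g).
Proof.
move=> [N1 _ _] Ng; apply: mem_ideal_gen; split=> [h|].
  move=> /(fsubsetP (msuppB_le _ _)) /fsetUP[].
    by move=> /(fsubsetP msuppU_le) /fset1P ->.
  by move=> /(fsubsetP msuppU_le) /fset1P ->.
by rewrite raddfB /= rmorph1 augmentation_of subrr.
Qed.

Lemma is_subgroup1 : is_subgroup [set 1%g : G].
Proof. by split=> [|x y -> ->|x ->] //; rewrite ?mulg1 ?invg1. Qed.

Lemma Phi1 : Phi R [set 1%g : G] = [set 0].
Proof.
apply/seteqP; split=> [|_ ->]; last first.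
  by case: (is_ideal_gen (augmentation_ideal R [set 1%g : G])).
apply: ideal_gen_min => [|a [a1 a0]].
  by split=> [|x y -> ->|c x ->] //=; rewrite ?addr0 ?mulr0.
apply/malgP => g; rewrite mcoeff0.
have [ga|/mcoeff_outdom //] := boolP (g \in msupp a).
have le : (msupp a `<=` [fset 1%g])%fset.
  by apply/fsubsetP => h /a1 ->; rewrite fset11.
by rewrite (a1 _ ga) -a0 (augmentationw le) big_seq_fset1.
Qed.

Lemma PhiT : Phi R [set: G] = [set a | augmentation a = 0].
Proof.
apply/seteqP; split=> a; first exact: Phi_augmentation.
by move=> a0; apply: mem_ideal_gen; split.
Qed.

Lemma Phi_nonunit N : nonunit_ideals RG (Phi R N).
Proof.
split=> [|NT]; first exact: is_ideal_gen.
have /Phi_augmentation : Phi R N 1 by rewrite NT.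
by rewrite rmorph1 => /eqP; rewrite oner_eq0.
Qed.

(** The coefficients of [1 - g - h + gh] over [N] add up to [0]; with [g] and
    [h] outside [N] only [1] and [gh] can contribute, and [1 != 0]. *)
Lemma Phi_mul2 N g h : is_subgroup N -> ~ N g -> ~ N h ->
  Phi R N ((1 - gr_of g) * (1 - gr_of h)) -> N (g * h)%g /\ 2%:R = 0 :> R.
Proof.
move=> sN Ng Nh /(Phi_coset_sum 1%g sN).
rewrite mulrBl mul1r mulrBr mulr1 -gr_ofM -gr_of1 !raddfB /= !coset_sum_of.
rewrite !mul1g.
have [N1 _ _] := sN.
rewrite (asboolT N1) (asboolF Ng) (asboolF Nh).
rewrite mulr0n mulr1n oppr0 addr0 add0r opprK.
case: asboolP => [Ngh|_ /eqP]; last by rewrite addr0 oner_eq0.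
by rewrite mulr1n -mulr2n.
Qed.

End Cosets.

(** * Consequences of every non-unit principal ideal being some Phi R N *)

Section Necessity.
Context (R : comNzRingType) (G : abelianGroupType).
Local Notation RG := (group_ring R G).
Implicit Types (a u : RG) (g h : G).
Hypothesis principalP : forall I : set RG, principal_ideal I ->
  I <> [set: RG] -> (Phi R @` subgroups G) I.

(** A non-unit [a] generates some [Phi R N], which lies in the kernel of the
    augmentation. *)
Lemma augmentation_neq0_unit a : augmentation a != 0 -> exists b, b * a = 1.
Proof.
move=> a0; have [aT|/principalP[|N _ Na]] := pselect (ideal_gen [set a] = setT).
- have /mem_principal[b ->] : ideal_gen [set a] 1 by rewrite aT.
  by exists b.
- by exists a.
- have /Phi_augmentation/eqP : Phi R N a by rewrite Na; apply: mem_ideal_gen.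
  by rewrite (negPf a0).
Qed.

Lemma augmentation_neq0_reg a u : augmentation u != 0 -> a * u = 0 -> a = 0.
Proof.
move=> /augmentation_neq0_unit[b bu] au.
by rewrite -[a]mulr1 -bu mulrCA au mulr0.
Qed.

Lemma principal_field : is_field R.
Proof.
move=> r r0.
have [|b /(congr1 (@augmentation R G))] := @augmentation_neq0_unit (r *: 1).
  by rewrite linearZ /= rmorph1 mulr1.
rewrite rmorphM rmorph1 /= linearZ /= rmorph1 mulr1.
by exists (augmentation b).
Qed.

(** The ideal of [(1 - g) * (1 - h)] is [Phi R N] for some [N] containing
    neither [g] nor [h], so [Phi_mul2] puts [g * h] in [N]. *)
Lemma of_mul2 g h : g <> 1%g -> h <> 1%g ->
  2%:R = 0 :> R /\
  exists b,
    1 - gr_of R (g * h)%g = b * ((1 - gr_of R g) * (1 - gr_of R h)) :> RG.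
Proof.
move=> g1 h1; set a : RG := (1 - gr_of R g) * (1 - gr_of R h).
have aug1 k : augmentation (1 - gr_of R k : RG) = 0.
  by rewrite raddfB /= rmorph1 augmentation_of subrr.
(* If k were in N then 1 - k = b (1 - k) (1 - l), and 1 - k would be killed by
   the unit 1 - b (1 - l). *)
have notin k l N : k <> 1%g -> is_subgroup N ->
    Phi R N = ideal_gen [set (1 - gr_of R k) * (1 - gr_of R l) : RG] -> ~ N k.
  move=> k1 sN Nkl /(@Phi_of R _ _ _ sN); rewrite Nkl => /mem_principal[b e].
  apply: k1; apply/esym/(@gr_of_inj R)/eqP; rewrite -subr_eq0 gr_of1; apply/eqP.
  apply: (@augmentation_neq0_reg _ (1 - b * (1 - gr_of R l))).
    by rewrite raddfB /= rmorph1 rmorphM /= aug1 mulr0 subr0 oner_eq0.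
  by rewrite mulrBr mulr1 [in X in X - _]e; ring.
have [||N sN Na] := @principalP (ideal_gen [set a]).
- by exists a.
- move=> aT; have /mem_principal[b] : ideal_gen [set a] 1 by rewrite aT.
  move=> /(congr1 (@augmentation R G))/eqP.
  by rewrite !rmorphM /= rmorph1 aug1 mul0r mulr0 oner_eq0.
have Ng : ~ N g by apply: (notin _ h).
have Nh : ~ N h by apply: (notin _ g) => //; rewrite mulrC.
have [|Ngh two0] := @Phi_mul2 R _ N g h sN Ng Nh.
  by rewrite Na; apply: mem_ideal_gen.
by split=> //; apply/mem_principal; rewrite -Na; apply: Phi_of.
Qed.

(** Otherwise [of_mul2] with [h = g^2] gives
    [(1 - g) (1 + g + g^2) = b (1 - g) (1 - g^2)]; cancelling a factor of
    augmentation [3 = 1] leaves [1 - g = 0]. *)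
Lemma exponent2 g : (g * g = 1)%g.
Proof.
have [//|gg1] := pselect (g * g = 1)%g.
have g1 : g <> 1%g by move=> e; apply: gg1; rewrite e mulg1.
have [two0 [b e]] := of_mul2 g1 gg1.
case: g1; apply/esym/(@gr_of_inj R)/eqP; rewrite -subr_eq0 gr_of1; apply/eqP.
apply: (@augmentation_neq0_reg _ (1 + gr_of R g + gr_of R g * gr_of R g
                                  - b * (1 - gr_of R (g * g)%g))).
  rewrite raddfB !raddfD /= !rmorphM /= raddfB /= rmorph1 !augmentation_of.
  rewrite subrr mulr0 subr0 mulr1.
  by rewrite -[1 + 1]/(2%:R) two0 add0r oner_eq0.
rewrite mulrBr; apply/eqP; rewrite subr_eq0; apply/eqP.
rewrite mulrCA -e !gr_ofM; ring.
Qed.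

(** In exponent and characteristic [2], [(1 - g)^2 = 0], so [of_mul2] gives
    [(1 - g) * (1 - g * h) = 0]; were [g] and [h] distinct, [Phi_mul2] with the
    trivial subgroup would yield [g * (g * h) = 1]. *)
Lemma nontrivial_unique g h : g <> 1%g -> h <> 1%g -> g = h.
Proof.
move=> g1 h1; have [two0 [b e]] := of_mul2 g1 h1.
have [//|gh] := pselect (g = h).
have gh1 : (g * h <> 1)%g.
  by move=> gh1; apply: gh; rewrite -[g]mulg1 -(exponent2 h) mulgA gh1 mul1g.
have two0G : 2%:R = 0 :> RG by rewrite -(scaler_nat 2 (1 : RG)) two0 scale0r.
have sq0 : (1 - gr_of R g) * (1 - gr_of R g) = 0 :> RG.
  have -> : (1 - gr_of R g) * (1 - gr_of R g) =
      1 + gr_of R g * gr_of R g - 2%:R * gr_of R g :> RG by ring.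
  by rewrite -gr_ofM exponent2 gr_of1 two0G mul0r subr0.
have [| | |] := @Phi_mul2 R _ [set 1%g] g (g * h)%g (@is_subgroup1 _) => //.
  by rewrite Phi1 /= e mulrCA [X in _ * X]mulrA sq0 mul0r mulr0.
by rewrite /= mulgA exponent2 mul1g.
Qed.

End Necessity.

(** * The group of order two over a field of characteristic two *)

Section Sufficiency.
Context (R : comNzRingType) (G : abelianGroupType) (g : G).
Local Notation RG := (group_ring R G).
Hypotheses (fieldR : is_field R) (two0 : 2%:R = 0 :> R).
Hypotheses (g1 : g <> 1%g) (G2 : forall h, h = 1%g \/ h = g).

Lemma gr_two_elements (a : RG) : a = (a@_1%g)%:A + a@_g *: gr_of R g.
Proof.
apply/malgP => h; rewrite mcoeffD !mcoeffZ -gr_of1 !mcoeffU.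
have g1' : (1%g == g) = false by apply/eqP => e; apply: g1.
case: (G2 h) => ->; rewrite !eqxx ?g1' 1?[g == _]eq_sym ?g1'.
  by rewrite mulr1 mulr0 addr0.
by rewrite mulr1 mulr0 add0r.
Qed.

(** By Frobenius and [g^2 = 1], the square of [r + s g] is the constant
    [r^2 + s^2 = (r + s)^2], so [a / (augmentation a)^2] inverts [a]. *)
Lemma augmentation_neq0_inv (a : RG) :
  augmentation a != 0 -> exists b, b * a = 1.
Proof.
move=> /fieldR[y ya]; exists ((y * y) *: a).
have gg : gr_of R g * gr_of R g = 1 :> RG.
  rewrite -gr_ofM; case: (G2 (g * g)%g) => [-> //|gg].
  by case: g1; rewrite -[g](mulgK g) gg mulgV.
have two0G : 2%:R = 0 :> RG by rewrite -(scaler_nat 2 (1 : RG)) two0 scale0r.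
have aE := gr_two_elements a; move: (a@_1%g) (a@_g) aE => r s aE.
have augE : augmentation a = r + s.
  by rewrite aE raddfD /= !linearZ /= rmorph1 augmentation_of !mulr1.
have -> : (y * y) *: a * a = ((y * augmentation a) * (y * augmentation a))%:A.
  rewrite -scalerAl augE aE.
  set u := gr_of R g in gg *.
  have -> : s *: u = s%:A * u by rewrite -scalerAl mul1r.
  have -> : (r%:A + s%:A * u) * (r%:A + s%:A * u) =
      (r%:A + s%:A) * (r%:A + s%:A).
    transitivity (r%:A * r%:A + s%:A * s%:A * (u * u)
                  + 2%:R * (r%:A * s%:A * u)); first by ring.
    transitivity (r%:A * r%:A + s%:A * s%:A + 2%:R * (r%:A * s%:A) : RG).
      by rewrite gg two0G; ring.
    by ring.
  rewrite -scalerDl -scalerAl mul1r !scalerA; congr (_ *: _); ring.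
by rewrite ya mulr1 scale1r.
Qed.

(** The kernel of the augmentation is the line [R (g - 1)], so over a field an
    ideal inside it is [0] or the whole kernel. *)
Lemma ideals_two_elements (I : set RG) :
  nonunit_ideals RG I -> (Phi R @` subgroups G) I.
Proof.
move=> [idI IT]; have [I0 ID IM] := idI.
have Iaug a : I a -> augmentation a = 0.
  move=> Ia; apply/eqP; apply: contrapT => /negP /augmentation_neq0_inv[b ba].
  by apply: IT; apply: ideal_eqT => //; rewrite -ba; apply: IM.
have [I0'|nI0] := pselect (I = [set 0]).
  by exists [set 1%g]; [apply: is_subgroup1 | rewrite Phi1].
exists setT => //; rewrite PhiT; apply/seteqP; split=> [b|]; last exact: Iaug.
have [a Ia a0] : exists2 a, I a & a != 0.
  apply: contrapT => H; apply: nI0; apply/seteqP; split=> [a Ia|_ -> //].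
  by apply/eqP; apply: contrapT => /negP a0; apply: H; exists a.
have kerE c : augmentation c = 0 -> c = c@_g *: (gr_of R g - 1).
  move=> c0; have cE := gr_two_elements c; move: (c@_1%g) (c@_g) cE => r s cE.
  have : r + s = 0.
    by rewrite -c0 cE raddfD /= !linearZ /= rmorph1 augmentation_of !mulr1.
  move/eqP; rewrite addr_eq0 => /eqP rE.
  by rewrite cE rE scaleNr scalerBr addrC.
move=> /= /kerE ->; have aE := kerE a (Iaug a Ia).
have /fieldR[y ya] : a@_g != 0.
  by apply: contraNneq a0 => ag0; rewrite aE ag0 scale0r.
suff -> : b@_g *: (gr_of R g - 1) = (b@_g * y)%:A * a by apply: IM.
by rewrite -scalerAl mul1r [in RHS]aE scalerA -mulrA ya mulr1.
Qed.

End Sufficiency.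

(** * The equivalence *)

Theorem theorem3p7 (R : comNzRingType) (G : abelianGroupType)
    (G_neq1 : [set: G] <> [set 1%g]) :
  [<-> Phi R @` subgroups G = nonunit_ideals (group_ring R G);
       forall I : set (group_ring R G), principal_ideal I ->
         I <> [set: group_ring R G] -> (Phi R @` subgroups G) I;
       [/\ is_field R, 2%N \in [pchar R] & [set: G] #= `I_2]].
Proof.
have [g g1] : exists g : G, g <> 1%g.
  apply: contrapT => H; apply: G_neq1; apply/seteqP; split=> // g _.
  by apply: contrapT => g1; apply: H; exists g.
tfae=> [PhiE I [a ->] IT|principalP|[fieldR char2 cardG]].
- by rewrite PhiE; split=> //; apply: is_ideal_gen.
- have [two0 _] := of_mul2 principalP g1 g1.
  split; [exact: (principal_field principalP) | by rewrite inE /= two0 |].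
  have -> : [set: G] = [set 1%g; g].
    apply/seteqP; split=> // h _.
    have [->|h1] := pselect (h = 1%g); first by left.
    by right; apply: (nontrivial_unique principalP).
  apply/eq_cardSP; exists g; first by right.
  suff -> : [set 1%g; g] `\ g = [set 1%g] by apply: card_set1.
  by apply/seteqP; split=> [h [[]]|_ ->] //; split; [left | move/esym].
- have two0 : 2%:R = 0 :> R by move: char2; rewrite inE => /andP[_ /eqP].
  have G2 h : h = 1%g \/ h = g.
    have [x _ /eq_cardSP[y _]] := elimT (@eq_cardSP _ _ 1) cardG.
    rewrite II0 card_eq0 => /eqP/seteqP[sub _].
    have xy k : k = x \/ k = y.
      have [|kx] := pselect (k = x); first by left.
      by have [|ky] := pselect (k = y); [right | case: (sub k)].
    by case: (xy h) (xy g) (xy 1%g) g1 => -> [] -> [] -> //; by [left | right].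
  apply/seteqP; split=> [_ [N _ <-]|I]; first exact: Phi_nonunit.
  exact: (@ideals_two_elements _ _ g).
Qed.
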